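(* Let $A\subseteq \mathbb{R}$. The following are equivalent: (i) $H(A)$ is a $\gamma$-space. (ii) $\mathbb{R}\setminus A$ is an $F_\sigma$ set in $\mathbb{S}^\star$. (iii) $H(A)$ is a quasimetrizable space.
   Context: For $A\subseteq\mathbb{R}$, the Hattori space $H(A)$ is the set $\mathbb{R}$ with the topology $\tau(A)$ in which a point $x\in A$ has the local base $\{(x-\varepsilon,x+\varepsilon) : \varepsilon>0\}$ and a point $x\in\mathbb{R}\setminus A$ has the local base $\{[x,x+\varepsilon) : \varepsilon>0\}$. $\mathbb{S}^\star$ denotes the inverted Sorgenfrey line: the set $\mathbb{R}$ with the topology having as a base the intervals $(a,b]$, $a<b$. A space $(X,\tau)$ is a $\gamma$-space if there is a function $g:\mathbb{N}\times X\to\tau$ such that for each $x\in X$ the family $\{g(n,x): n\in\mathbb{N}\}$ is a local base at $x$ (with $x\in g(n,x)$ for all $n$), and for each $n\in\mathbb{N}$ and $x\in X$ there is $m\in\mathbb{N}$ such that $y\in g(m,x)$ implies $g(m,y)\subseteq g(n,x)$. A space $X$ is quasimetrizable if there is $d:X\times X\to[0,\infty)$ with $d(x,y)=0$ iff $x=y$ and $d(x,z)\le d(x,y)+d(y,z)$ for all $x,y,z$ (symmetry not required), such that for each $x$ the sets $\{y: d(x,y)<\varepsilon\}$, $\varepsilon>0$, form a local base at $x$. *)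

(* Defs.v *)
From HB Require Import structures.
From mathcomp Require Import all_boot all_order all_algebra.
From mathcomp Require Import all_classical all_reals all_analysis.
From mathcomp Require Import lra.

Set Implicit Arguments.
Unset Strict Implicit.
Unset Printing Implicit Defensive.

Import Order.TTheory GRing.Theory Num.Theory.
Import numFieldNormedType.Exports.

Local Open Scope classical_set_scope.
Local Open Scope ring_scope.

(* As usual, the members of a local base are required to be open. *)
Definition local_base (T : topologicalType) (x : T) (B : set (set T)) : Prop :=
  B `<=` open_nbhs x /\ forall V, nbhs x V -> exists2 U, B U & U `<=` V.

(* Openness of [g n x] and [x \in g n x] are part of [local_base]. *)
Definition gamma_space (T : topologicalType) : Prop :=
  exists g : nat -> T -> set T,
    (forall x, local_base x [set g n x | n in [set: nat]]) /\
    (forall n x, exists m, forall y, g m x y -> g m y `<=` g n x).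

Definition quasimetric (R : realType) (T : Type) (d : T -> T -> R) : Prop :=
  [/\ forall x y, 0 <= d x y,
      forall x y, d x y = 0 <-> x = y &
      forall x y z, d x z <= d x y + d y z].

Definition quasimetrizable (R : realType) (T : topologicalType) : Prop :=
  exists2 d : T -> T -> R, quasimetric d &
    forall x, local_base x
      [set [set y | d x y < e] | e in [set e : R | 0 < e]].

(* The Hattori space of [A], as an alias of [R] carrying its own topology. *)
Definition hattori (R : realType) (A : set R) : Type := R.

Definition hattori_ball (R : realType) (A : set R) (x e : R) : set R :=
  if x \in A then `]x - e, x + e[%classic else `[x, x + e[%classic.

Section hattori_topology.
Context (R : realType) (A : set R).

HB.instance Definition _ := Choice.copy (hattori A) R.

HB.instance Definition _ := hasNbhs.Build (hattori A)
  (fun x : R => filter_from [set e : R | 0 < e] (hattori_ball A x)).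

Let nbhs_hattoriE (x : hattori A) :
  nbhs x = filter_from [set e : R | 0 < e] (hattori_ball A x).
Proof. by []. Qed.

Lemma hattori_ball_center (x e : R) : 0 < e -> hattori_ball A x e x.
Proof.
move=> e0; rewrite /hattori_ball; case: ifP => _ /=; rewrite in_itv/=.
  by rewrite ltrBlDr ltrDl e0.
by rewrite lexx ltrDl e0.
Qed.

Lemma hattori_ball_le (x e f : R) :
  e <= f -> hattori_ball A x e `<=` hattori_ball A x f.
Proof.
move=> ef y; rewrite /hattori_ball; case: ifP => _ /=; rewrite !in_itv/=.
  by move=> /andP[xy yx]; apply/andP; split; lra.
by move=> /andP[xy yx]; apply/andP; split; lra.
Qed.

Lemma hattori_ball_open (x e y : R) : hattori_ball A x e y ->
  exists2 f, 0 < f & hattori_ball A y f `<=` hattori_ball A x e.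
Proof.
rewrite /hattori_ball; case: ifPn => xA /=; rewrite in_itv/= => /andP[xy yx].
  exists (Num.min (y - (x - e)) (x + e - y)).
    by rewrite lt_min !subr_gt0 xy yx.
  case: ifPn => yA z /=; rewrite !in_itv/=.
    case: (leP (y - (x - e)) (x + e - y)) => h /andP[? ?];
      by apply/andP; split; lra.
  case: (leP (y - (x - e)) (x + e - y)) => h /andP[? ?];
    by apply/andP; split; lra.
case: (eqVneq y x) => [->|yNx].
  by exists e => //; [lra | rewrite (negbTE xA)].
have {}xy : x < y by rewrite lt_neqAle eq_sym yNx.
exists (Num.min (y - x) (x + e - y)); first by rewrite lt_min !subr_gt0 xy yx.
case: ifPn => yA z /=; rewrite !in_itv/=.
  case: (leP (y - x) (x + e - y)) => h /andP[? ?];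
    by apply/andP; split; lra.
case: (leP (y - x) (x + e - y)) => h /andP[? ?];
  by apply/andP; split; lra.
Qed.

Let hattori_nbhs_filter (x : hattori A) : ProperFilter (nbhs x).
Proof.
rewrite nbhs_hattoriE; apply: filter_from_proper; last first.
  by move=> e e0; exists x; exact: hattori_ball_center.
apply: filter_from_filter; first by exists 1 => /=.
move=> e f /= e0 f0; exists (Num.min e f); first by rewrite /= lt_min e0 f0.
by move=> y xy; split; apply: hattori_ball_le xy; rewrite ge_min lexx ?orbT.
Qed.

Let hattori_nbhs_singleton (x : hattori A) (B : set (hattori A)) :
  nbhs x B -> B x.
Proof. by rewrite nbhs_hattoriE => -[e e0]; apply; exact: hattori_ball_center. Qed.

Let hattori_nbhs_nbhs (x : hattori A) (B : set (hattori A)) :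
  nbhs x B -> nbhs x (nbhs^~ B).
Proof.
rewrite nbhs_hattoriE => -[e e0 xeB]; exists e => // y /hattori_ball_open[f f0 yf].
by rewrite /= nbhs_hattoriE; exists f => //; exact: subset_trans xeB.
Qed.

HB.instance Definition _ := Nbhs_isNbhsTopological.Build (hattori A)
  hattori_nbhs_filter hattori_nbhs_singleton hattori_nbhs_nbhs.

Lemma nbhs_hattori (x : hattori A) :
  nbhs x = filter_from [set e : R | 0 < e] (hattori_ball A x).
Proof. by []. Qed.

Lemma open_hattori_ball (x e : R) : open (hattori_ball A x e : set (hattori A)).
Proof.
rewrite openE => y /hattori_ball_open[f f0 yf].
by rewrite /interior nbhs_hattoriE; exists f.
Qed.

Lemma local_base_hattori (x : hattori A) :
  local_base x [set (hattori_ball A x e : set (hattori A)) | e in [set e | 0 < e]].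
Proof.
split=> [_ [e e0 <-]|V [e e0 xeV]].
  by split; [exact: open_hattori_ball|exact: hattori_ball_center].
by exists (hattori_ball A x e) => //; exists e.
Qed.

End hattori_topology.

(* The inverted Sorgenfrey line. *)
Definition inv_sorgenfrey (R : realType) : Type := R.

Section inv_sorgenfrey_topology.
Context (R : realType).

HB.instance Definition _ := Choice.copy (inv_sorgenfrey R) R.

Let D : set (R * R) := [set ab | ab.1 < ab.2].

Let b (ab : R * R) : set (inv_sorgenfrey R) := `]ab.1, ab.2]%classic.

Let b_cover : \bigcup_(ab in D) b ab = setT.
Proof.
apply/seteqP; split => // x _; exists (x - 1 : R, x : R) => /=.
  by rewrite /D/= gtrBl.
by rewrite /b/= in_itv/= lexx gtrBl ltr01.
Qed.

Let b_join (i j : R * R) (t : inv_sorgenfrey R) : D i -> D j ->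
  b i t -> b j t -> exists k, [/\ D k, b k t & b k `<=` b i `&` b j].
Proof.
move: i j => [i1 i2] [j1 j2]; rewrite /D /b /= => _ _.
rewrite !in_itv/= => /andP[i1t ti2] /andP[j1t tj2].
exists (Num.max i1 j1, t); split => /=.
- by rewrite gt_max i1t j1t.
- by rewrite in_itv/= lexx gt_max i1t j1t.
- move=> y /=; rewrite !in_itv/= gt_max => /andP[/andP[-> ->] yt] /=.
  by rewrite (le_trans yt ti2) (le_trans yt tj2).
Qed.

HB.instance Definition _ :=
  isBaseTopological.Build (inv_sorgenfrey R) b_cover b_join.

Lemma basis_inv_sorgenfrey :
  basis [set (`]ab.1, ab.2]%classic : set (inv_sorgenfrey R))
        | ab in [set ab : R * R | ab.1 < ab.2]].
Proof.
split=> [_ [ab abD <-]|x V [_ [[D' D'D <-] [ab D'ab abx] D'V]]].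
  by exists [set ab]; rewrite ?bigcup_set1// => _ ->.
exists `]ab.1, ab.2]%classic; first by split=> //; exists ab => //; exact: D'D.
by move=> y aby; apply: D'V; exists ab.
Qed.

End inv_sorgenfrey_topology.

(* Main.v *)
(* (i) -> (ii): for a gamma-function [g], put
     F(m, q) = {x | forall y in [x, x + 1/(q+1)), g m y is included in [x, oo)}.
   These sets are closed under limits from the left, they miss [A] (take
   [y = x]), and the gamma property places each point of [~` A] in one of them.
   (ii) -> (iii): for [F] closed in the inverted Sorgenfrey line, the indicator
   of "[F] meets ]y, x]" is a quasi-pseudometric in [(x, y)]; if [~` A] is the
   union of the [F n], add to [`|x - y|] the largest [1/(n+1)] such that [F n]
   meets ]y, x].
   (iii) -> (i): take balls of radius [1/(n+1)]. *)
Require Import Defs.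
From mathcomp Require Import all_boot all_order all_algebra.
From mathcomp Require Import all_classical all_reals all_analysis.
From mathcomp Require Import borel_hierarchy.
From mathcomp Require Import lra.
Import Order.TTheory GRing.Theory Num.Theory.
Import numFieldNormedType.Exports.

Local Open Scope classical_set_scope.

(** A basic set ]a, b] containing x can be cut down to ]a, x], so only gaps to the left of x
    matter. *)
Lemma closed_inv_sorgenfreyP (R : realType) (F : set R) :
  @closed (inv_sorgenfrey R) F <->
  (forall x : R, ~ F x ->
    exists2 e : R, (0 < e)%R & forall y : R, (x - e < y <= x)%R -> ~ F y).
Proof.
have [bopen bcvg] := basis_inv_sorgenfrey R.
rewrite -(@openC (inv_sorgenfrey R)) openE; split=> [Fc x Fx|Fc x /= Fx].
  have [U [[[a b] /= ab <-]]] := bcvg x _ (Fc x Fx).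
  rewrite /= in_itv/= => /andP[ax xb] abF; exists (x - a)%R.
    by rewrite subr_gt0.
  move=> y /andP[xy yx]; apply: abF; rewrite /= in_itv/= (le_trans yx xb) andbT.
  lra.
have [e e0 xeF] := Fc x Fx.
apply: (@filterS _ (nbhs (x : inv_sorgenfrey R)) _
  (`](x - e)%R, x]%classic : set (inv_sorgenfrey R))).
  by move=> y /=; rewrite in_itv/=; exact: xeF.
apply: open_nbhs_nbhs; split; last by rewrite /= in_itv/= lexx andbT; lra.
by apply: bopen; exists ((x - e)%R, x) => //=; lra.
Qed.

Lemma gamma_space_Fsigma (R : realType) (A : set R) :
  gamma_space (hattori A) -> @Fsigma (inv_sorgenfrey R) (~` A).
Proof.
move=> [g [gb gg]].
pose G (mq : nat * nat) : set R := [set x : R | forall y : R,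
  (x <= y < x + mq.2.+1%:R^-1)%R -> g mq.1 y `<=` [set z : R | x <= z]%R].
have Gclosed mq : @closed (inv_sorgenfrey R) (G mq).
  apply/closed_inv_sorgenfreyP => p; apply: contra_notP => nex y ypq z gyz.
  pose q : R := (mq.2.+1%:R^-1)%R.
  move: ypq => /andP[py]; rewrite -/q => ypq /=; rewrite leNgt; apply/negP => zp.
  (* With this radius every x in ]p - e, p] satisfies z < x <= y < x + q, so x in [G mq] would force
     x <= z. *)
  apply: nex; exists (Num.min (p - z) (p + q - y))%R.
    by rewrite lt_min !subr_gt0 zp ypq.
  move=> x /andP[px xp] Gx.
  have [xz xyq] : (z < x /\ y < x + q)%R.
    by move: px; rewrite ltrBlDr -ltrBlDl lt_min => /andP[? ?]; split; lra.
  have : (x <= y < x + q)%R by rewrite xyq (le_trans xp py).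
  by move=> /(Gx y)/(_ z gyz) /=; rewrite leNgt xz.
have Gcover x : ~ A x -> exists mq, G mq x.
  move=> Ax; have xA : (x \in A) = false by apply/negbTE; rewrite notin_setE.
  (* Choose n with [g n x] inside [x, x + 1), then m by the gamma property, then q with [x, x +
     1/(q+1)) inside [g m x]. *)
  have [_ /(_ _ (ex_intro2 _ _ 1%R ltr01 (@subset_refl _ _)))] := gb x.
  move=> [_ [n _ <-] gnx]; have [m gm] := gg n x.
  have [gbo _] := gb x.
  have [e /= e0 xe] : nbhs (x : hattori A) (g m x).
    by apply: open_nbhs_nbhs; apply: gbo; exists m.
  have [q] := ltr_add_invr e0; rewrite add0r => qe.
  exists (m, q) => y /= /andP[xy yx] z gmyz.
  have /gm/(_ z gmyz)/gnx : g m x y.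
    by apply: xe; rewrite /hattori_ball xA /= in_itv/= xy (lt_trans yx)// ltrD2l.
  by rewrite /hattori_ball xA /= in_itv/= => /andP[].
have GA mq x : G mq x -> ~ A x.
  move=> Gx Ax; have [gbo _] := gb x.
  have [e /= e0 xe] : nbhs (x : hattori A) (g mq.1 x).
    by apply: open_nbhs_nbhs; apply: gbo; exists mq.1.
  have : (x <= x < x + mq.2.+1%:R^-1)%R by rewrite lexx ltrDl invr_gt0 ltr0n.
  (* As x is in A, its neighbourhood [g mq.1 x] contains points to the left of x, such as x -
     e/2. *)
  move=> /(Gx x)/(_ (x - e / 2)%R) /= xxe.
  suff /xxe : g mq.1 x (x - e / 2)%R by lra.
  by apply: xe; rewrite /hattori_ball mem_set//= in_itv/=; apply/andP; split; lra.
(* Pairs are enumerated by their codes; a k that codes no pair gets (0, 0), which is harmless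
   because every [G mq] misses A. *)
exists (fun k => G (odflt (0, 0)%N (unpickle k))); first by move=> k; exact: Gclosed.
apply/seteqP; split=> x => [/Gcover[mq Gx]|[k _ /GA]//].
by exists (pickle mq); rewrite ?pickleK.
Qed.

Section jump.
Context {R : realType} (F : nat -> set R).
Implicit Types x y z : R.
Local Open Scope ring_scope.

(** The element 0 keeps the set nonempty and makes the supremum 0 when no [F n] meets ]y, x], in
    particular when x <= y. *)
Definition jump_set x y : set R :=
  [set r | r = 0 \/
    exists2 n, F n `&` `]y, x] !=set0 & r = n.+1%:R^-1].

Definition jump x y : R := sup (jump_set x y).

Lemma jump_has_ubound x y : has_ubound (jump_set x y).
Proof.
exists 1 => r [->|[n _ ->]]; first exact: ler01.
by rewrite invf_le1// ler1n.
Qed.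

Lemma jump_ge0 x y : 0 <= jump x y.
Proof. by apply: ub_le_sup; [exact: jump_has_ubound|left]. Qed.

Lemma jump_ge x y n : F n `&` `]y, x] !=set0 -> n.+1%:R^-1 <= jump x y.
Proof. by move=> Fn; apply: ub_le_sup; [exact: jump_has_ubound|right; exists n]. Qed.

Lemma jump_le x y r : 0 <= r ->
  (forall n, F n `&` `]y, x] !=set0 -> n.+1%:R^-1 <= r) -> jump x y <= r.
Proof.
move=> r0 Fr; apply: ge_sup; first by exists 0; left.
by move=> _ [->//|[n Fn ->]]; exact: Fr.
Qed.

Lemma jump_eq0 x y : x <= y -> jump x y = 0.
Proof.
move=> xy; apply/eqP; rewrite eq_le jump_ge0 andbT.
apply: jump_le => // n [z [_]] /=; rewrite in_itv/= => /andP[yz zx].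
by have := lt_le_trans yz (le_trans zx xy); rewrite ltxx.
Qed.

(** A point of [F n] in ]z, x] lies in ]z, y] or in ]y, x], so one of the two jumps is already at
    least 1/(n+1). *)
Lemma jump_triangle x y z : jump x z <= jump x y + jump y z.
Proof.
apply: jump_le => [|n [t [Ft /=]]]; first by rewrite addr_ge0// jump_ge0.
rewrite in_itv/= => /andP[zt tx]; have [ty|yt] := leP t y.
  rewrite ler_wpDl ?jump_ge0//; apply: jump_ge.
  by exists t; split => //=; rewrite in_itv/= zt.
rewrite ler_wpDr ?jump_ge0//; apply: jump_ge.
by exists t; split => //=; rewrite in_itv/= yt.
Qed.

Definition jump_dist x y : R := `|x - y| + jump x y.

Lemma quasimetric_jump_dist : quasimetric jump_dist.
Proof.
split=> [x y|x y|x y z]; first by rewrite addr_ge0// jump_ge0.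
- split=> [/eqP|->]; last by rewrite /jump_dist subrr normr0 jump_eq0// addr0.
  rewrite paddr_eq0 ?jump_ge0// => /andP[+ _].
  by rewrite normr_eq0 subr_eq0 => /eqP.
- rewrite /jump_dist addrACA; apply: lerD; last exact: jump_triangle.
  exact: ler_distD.
Qed.

End jump.

(** By the triangle inequality, the ball of radius e - d x y around y stays in the e-ball around x;
    hence balls are open as soon as they are neighbourhoods of their centres. *)
Lemma quasimetric_local_base (R : realType) (T : topologicalType)
    (d : T -> T -> R) : quasimetric d ->
  (forall (x : T) (r : R), (0 < r)%R -> nbhs x [set y | (d x y < r)%R]) ->
  (forall (x : T) (V : set T), nbhs x V ->
    exists2 r : R, (0 < r)%R & [set y | (d x y < r)%R] `<=` V) ->
  forall x : T, local_base x
    [set [set y | (d x y < e)%R] | e in [set e : R | (0 < e)%R]].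
Proof.
move=> [_ d0 dtri] dnbhs nbhsd x; split=> [_ [e e0 <-]|V /nbhsd[r r0 rV]].
  split; last by rewrite /= (d0 x x).2.
  rewrite openE => y /= xye.
  have exy : (0 < e - d x y)%R by rewrite subr_gt0.
  apply: filterS (dnbhs y _ exy) => z /= yz.
  by rewrite (le_lt_trans (dtri x y z))// -ltrBrDl.
by exists [set y | (d x y < r)%R] => //; exists r.
Qed.

Lemma ball_jump_dist (R : realType) (A : set R) (F : nat -> set R) :
  (forall n, @closed (inv_sorgenfrey R) (F n)) -> ~` A = \bigcup_n F n ->
  forall x r : R, (0 < r)%R ->
    nbhs (x : hattori A) [set y | (jump_dist F x y < r)%R].
Proof.
move=> Fc AF x r r0.
have right y : (x <= y < x + r)%R -> (jump_dist F x y < r)%R.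
  move=> /andP[xy yx]; rewrite /jump_dist jump_eq0// addr0 distrC.
  rewrite ger0_norm ?subr_ge0//; lra.
have [xA|xA] := boolP (x \in A); last first.
  exists r => // y; rewrite /hattori_ball (negbTE xA) /= in_itv/=.
  exact: right.
have xF n : ~ F n x.
  by move=> Fx; have : (~` A) x by [rewrite AF; exists n]; apply; exact: set_mem.
have r20 : (0 < r / 2)%R by lra.
(* Indices n >= N contribute at most 1/(N+1) < r/2 to the jump. The finitely many closed sets [F n]
   with n < N miss x, hence share a gap to its left. *)
have [N] := ltr_add_invr r20; rewrite add0r => Nr.
have [e e0 eF] : exists2 e : R, (0 < e)%R &
    forall n, (n < N)%N -> forall y : R, (x - e < y <= x)%R -> ~ F n y.
  elim: N {Nr} => [|N [e e0 eF]]; first by exists 1%R.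
  have /closed_inv_sorgenfreyP/(_ x (xF N))[f f0 fF] := Fc N.
  exists (Num.min e f); first by rewrite lt_min e0.
  move=> n; rewrite ltnS leq_eqVlt => nN y /andP[xy yx].
  have [ey fy] : (x - e < y /\ x - f < y)%R.
    by move: xy; rewrite ltrBlDr -ltrBlDl lt_min => /andP[? ?]; split; lra.
  move: nN => /predU1P[->|nN]; first by apply: fF; rewrite fy.
  by apply: eF nN _ _; rewrite ey.
exists (Num.min e (r / 2))%R => /=; first by rewrite lt_min e0.
move=> y; rewrite /hattori_ball xA /= in_itv/= => /andP[].
rewrite ltrBlDr -ltrBlDl lt_min -ltrBlDl lt_min => /andP[xye xyr] /andP[_ yxr].
have [xy|yx] := leP x y; first by apply: right; apply/andP; split; lra.
have jr : (jump F x y <= r / 2)%R.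
  apply: jump_le => [|n [t [Ft /=]]]; first exact: ltW.
  rewrite in_itv/= => /andP[yt tx]; have [nN|Nn] := ltnP n N.
    by exfalso; apply: (eF n nN t _ Ft); apply/andP; split; lra.
  apply: le_trans (ltW Nr); rewrite lef_pV2 ?posrE// ler_nat ltnS//.
rewrite /jump_dist ger0_norm; lra.
Qed.

(** The term |x - y| suffices at points of A. Any other x lies in some [F n]; each y < x then has x
    in ]y, x], so its jump is at least 1/(n+1) and a radius of at most 1/(n+1) excludes it. *)
Lemma jump_dist_ball (R : realType) (A : set R) (F : nat -> set R) :
  ~` A = \bigcup_n F n ->
  forall (x : hattori A) (V : set R), nbhs x V ->
    exists2 r : R, (0 < r)%R & [set y | (jump_dist F x y < r)%R] `<=` V.
Proof.
move=> AF x V [e /= e0 xeV]; rewrite /hattori_ball in xeV.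
have near_x y : (jump_dist F x y < e)%R -> (x - e < y < x + e)%R.
  move=> xye; rewrite -ltr_distlC; apply: le_lt_trans xye.
  by rewrite /jump_dist lerDl jump_ge0.
case: ifPn xeV => [xA|xA] xeV.
  by exists e => // y /near_x xy; apply: xeV; rewrite /= in_itv.
have [n _ Fnx] : (\bigcup_n F n) x by rewrite -AF => Ax; move: xA; rewrite mem_set.
exists (Num.min e n.+1%:R^-1)%R; first by rewrite lt_min e0 invr_gt0 ltr0n.
move=> y; rewrite /= lt_min => /andP[/near_x/andP[_ yx] xyn].
apply: xeV; rewrite /= in_itv/= yx andbT leNgt; apply: contraPN xyn => yltx.
apply/negP; rewrite -leNgt; apply: (@le_trans _ _ (jump F x y)).
  by apply: jump_ge; exists x; split => //=; rewrite in_itv/= yltx lexx.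
by rewrite /jump_dist lerDr.
Qed.

Lemma Fsigma_quasimetrizable (R : realType) (A : set R) :
  @Fsigma (inv_sorgenfrey R) (~` A) -> quasimetrizable R (hattori A).
Proof.
move=> [F Fc AF]; exists (jump_dist F); first exact: quasimetric_jump_dist.
apply: (@quasimetric_local_base R (hattori A)).
- exact: quasimetric_jump_dist.
- exact: ball_jump_dist.
- exact: jump_dist_ball.
Qed.

Lemma quasimetrizable_gamma_space (R : realType) (T : topologicalType) :
  quasimetrizable R T -> gamma_space T.
Proof.
move=> [d [_ _ dtri] db]; exists (fun n x => [set y | (d x y < n.+1%:R^-1)%R]).
split=> [x|n x].
  have [dopen dbase] := db x; split=> [_ [n _ <-]|V /dbase[_ [e e0 <-] eV]].
    by apply: dopen; exists n.+1%:R^-1%R => //=; rewrite invr_gt0 ltr0n.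
  have [n] := ltr_add_invr e0; rewrite add0r => ne.
  exists [set y | (d x y < n.+1%:R^-1)%R]; first by exists n.
  by move=> y /= xy; apply: eV; exact: lt_trans xy ne.
(* This index gives the radius 1/(2n+2), half of 1/(n+1), so two steps stay in the n-th ball. *)
exists n.*2.+1 => y /= xy z /= yz.
rewrite (le_lt_trans (dtri x y z))//.
have -> : (n.+1%:R^-1 = n.*2.+2%:R^-1 + n.*2.+2%:R^-1 :> R)%R.
  by rewrite -doubleS -muln2 natrM invfM -splitr.
exact: ltrD.
Qed.

Theorem theorem6 (R : realType) (A : set R) :
  [<-> gamma_space (hattori A);
       @Fsigma (inv_sorgenfrey R) (~` A);
       quasimetrizable R (hattori A)].
Proof.
tfae.
- exact: gamma_space_Fsigma.
- exact: Fsigma_quasimetrizable.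
- exact: quasimetrizable_gamma_space.
Qed.
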